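(* Let $n,p$ be positive integers, let $\lambda\vdash n$ be a partition with at most $p$ parts, let $t',t''$ be semistandard tableaux of shape $\lambda$ with entries in $[p]$, and let $D':=D(t',t_\lambda)$, $D'':=D(t'',t_\lambda)$. Then, as polynomials in the variables $x_{i,j}$ ($i,j=1,\ldots,p$), $$\sum_{D\in P(n,p)}x^D\,\langle A_De_{t'},e_{t''}\rangle=q\cdot\prod_{i>j}\bigl(D'_{i,j}!\,D''_{i,j}!\bigr)^{-1},$$ where $$q:=\prod_{j=1}^{p-1}\prod_{i=j+1}^{p}\Bigl((d_{i\to j})^{D''_{i,j}}(d^*_{j\to i})^{D'_{i,j}}\Bigr)\circ P_\lambda ,$$ i.e. $q$ is obtained by applying to $P_\lambda$ the composition of differential operators written from left to right in the order $j=1,\ldots,p-1$ and, for each $j$, $i=j+1,\ldots,p$ (the rightmost operator acting first).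
   Context: Notation: $[p]=\{1,\ldots,p\}$. For words $a,b\in[p]^n$, $D(a,b)\in\mathbb{N}^{p\times p}$ ($\mathbb{N}=\{0,1,2,\ldots\}$) is given by $(D(a,b))_{i,j}=|\{k\mid a_k=i,\ b_k=j\}|$. $P(n,p)$ is the set of $D\in\mathbb{N}^{p\times p}$ whose entries sum to $n$. For $D\in P(n,p)$, $A_D\in\mathbb{C}^{[p]^n\times[p]^n}$ is the $0/1$-matrix with $(A_D)_{a,b}=1$ iff $D(a,b)=D$. $V=\mathbb{C}^{[p]^n}$ has standard basis vectors $\chi^a$ ($a\in[p]^n$) and standard inner product $\langle x,y\rangle=y^*x$. $x^D:=\prod_{i,j=1}^p x_{i,j}^{D_{i,j}}$. A partition $\lambda\vdash n$ is a sequence of nonnegative integers $\lambda_1\ge\cdots\ge\lambda_n$ with sum $n$; it has at most $p$ parts if at most $p$ of the $\lambda_i$ are nonzero. Its dual partition is $\lambda^*_i=|\{j\mid\lambda_j\ge i\}|$. Its Ferrers diagram has $\lambda_i$ boxes in row $i$ (left-justified); the box in row $i$, column $j$ has number $\lambda_1+\cdots+\lambda_{i-1}+j$. A tableau $t$ of shape $\lambda$ is a filling of the boxes with entries from $[p]$, identified with the word $(t(1),\ldots,t(n))\in[p]^n$, $t(k)$ being the entry in box $k$; $(\sigma t)(k)=t(\sigma^{-1}(k))$ for $\sigma\in S_n$. A tableau is semistandard if entries are (strictly) increasing down each column and non-decreasing along each row. $t_\lambda$ is the tableau of shape $\lambda$ whose $i$-th row is filled with $i$'s. $C_\lambda\le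 S_n$ is the group of permutations of the boxes preserving each column; $t\sim t'$ means $t'=\pi t$ for some permutation $\pi$ of the boxes preserving each row. For a tableau $t$ of shape $\lambda$, $e_t:=\sum_{\sigma\in C_\lambda}\mathrm{sgn}(\sigma)\sum_{t'\sim t}\chi^{\sigma t'}$. Polynomials and operators: $Q_0:=1$ and $Q_k:=k!\,\det\bigl((x_{i,j})_{i,j=1}^k\bigr)$ for $k=1,\ldots,p$; $P_\lambda:=\prod_{i=1}^nQ_{\lambda^*_i}$. For $i,j\in[p]$, $$d_{i\to j}:=\sum_{s=1}^p x_{i,s}\frac{\partial}{\partial x_{j,s}},\qquad d^*_{i\to j}:=\sum_{s=1}^p x_{s,j}\frac{\partial}{\partial x_{s,i}}.$$ *)

(* Defs.v *)
From HB Require Import structures.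
From mathcomp Require Import all_boot all_order all_fingroup all_algebra.
From mathcomp Require Import mpoly.

Set Implicit Arguments.
Unset Strict Implicit.
Unset Printing Implicit Defensive.

Import Order.TTheory GRing.Theory Num.Theory.
Local Open Scope ring_scope.

(* All indices are 0-based: the letters [p] are 'I_p, the boxes 1, ..., n are  *)
(* 'I_n, and rows and columns of a Ferrers diagram start at 0.                *)

Definition word (n p : nat) : finType := {ffun 'I_n -> 'I_p}.

Definition Dmat (n p : nat) (a b : word n p) : 'M[nat]_p :=
  \matrix_(i, j) #|[set k | (a k == i) && (b k == j)]|.

Definition entry_sum (p : nat) (D : 'M[nat]_p) : nat := (\sum_i \sum_j D i j)%N.

(* P(n, p), as a duplicate-free list.  An entry of a matrix of total n is at  *)
(* most n, so enumerating matrices over 'I_n.+1 loses nothing: see mem_Pnp.   *)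
Definition Pnp (n p : nat) : seq 'M[nat]_p :=
  [seq D <- [seq map_mx (@nat_of_ord n.+1) E | E : 'M['I_n.+1]_p]
     | entry_sum D == n].

Lemma Pnp_uniq (n p : nat) : uniq (Pnp n p).
Proof.
apply/filter_uniq; rewrite map_inj_uniq ?enum_uniq // => E F /matrixP eqEF.
by apply/matrixP => i j; apply: val_inj; have := eqEF i j; rewrite !mxE.
Qed.

Lemma mem_Pnp (n p : nat) (D : 'M[nat]_p) : (D \in Pnp n p) = (entry_sum D == n).
Proof.
rewrite mem_filter andb_idr // => /eqP Dn; apply/mapP.
exists (\matrix_(i, j) inord (D i j)); first by rewrite mem_enum.
apply/matrixP => i j; rewrite !mxE inordK // ltnS -Dn /entry_sum.
by rewrite (bigD1 i) //= (bigD1 j) //= -addnA leq_addr.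
Qed.

(* The space C^([p]^n): column vectors and matrices whose indices are the     *)
(* words, numbered by enum_rank.                                              *)
Section Space.
Variables (C : numClosedFieldType) (n p : nat).

Definition Amx (D : 'M[nat]_p) : 'M[C]_#|word n p| :=
  \matrix_(i, j) (Dmat (enum_val i) (enum_val j) == D)%:R.

Definition chi (a : word n p) : 'cV[C]_#|word n p| :=
  delta_mx (enum_rank a) 0.

Definition inner (x y : 'cV[C]_#|word n p|) : C :=
  ((map_mx Num.conj y)^T *m x) 0 0.

End Space.

Record intpartn (n : nat) := IntPartn {
  part_seq :> n.-tuple nat;
  part_sorted : sorted geq part_seq;
  part_sum : sumn part_seq = n }.

Section Partition.
Variables (n : nat) (lam : intpartn n).

Definition nparts : nat := count (fun l => 0 < l)%N lam.

(* The dual partition; here i is 1-based, as lambda^*_i counts the parts >= i *)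
Definition dual (i : nat) : nat := count (fun l => i <= l)%N lam.

(* Row and column of a box, the boxes being numbered row by row               *)
Definition row_of (k : 'I_n) : nat := reshape_index lam k.
Definition col_of (k : 'I_n) : nat := reshape_offset lam k.

Lemma box_in_row k : (col_of k < nth 0 lam (row_of k))%N.
Proof. by apply: reshape_offsetP; rewrite part_sum. Qed.

Lemma row_of_lt_nparts k : (row_of k < nparts)%N.
Proof.
have [r_lt|] := ltnP (row_of k) (size lam); last first.
  by move=> /(nth_default 0%N) e; have := box_in_row k; rewrite e.
have gt0 : (0 < nth 0 lam (row_of k))%N by apply: leq_trans (box_in_row k).
rewrite /nparts -(cat_take_drop (row_of k).+1 lam) count_cat.
apply: leq_trans (leq_addr _ _).
have -> : count (fun l => 0 < l)%N (take (row_of k).+1 lam)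
    = size (take (row_of k).+1 lam).
  apply/eqP; rewrite -all_count; apply/(all_nthP 0%N) => i.
  rewrite size_takel // ltnS => le_ir; rewrite nth_take //.
  apply: leq_trans gt0 _.
  have geq_trans : transitive geq by move=> x y z /= ? /leq_trans; apply.
  have := sorted_leq_nth geq_trans leqnn 0%N (part_sorted lam).
  by apply; rewrite ?inE ?(leq_ltn_trans le_ir).
by rewrite size_takel.
Qed.

Lemma dual_le_nparts i : (0 < i)%N -> (dual i <= nparts)%N.
Proof. by move=> i0; apply: sub_count => l; apply: leq_trans. Qed.

End Partition.

Section Tableaux.
Variables (n p : nat) (lam : intpartn n).

(* A tableau of shape lam is identified with its word.                        *)
Definition semistandard (t : word n p) : bool :=
  [forall k, forall l,
     ((col_of lam k == col_of lam l) && (row_of lam k < row_of lam l)%N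
        ==> (t k < t l)%N)
  && ((row_of lam k == row_of lam l) && (col_of lam k <= col_of lam l)%N
        ==> (t k <= t l)%N)].

Definition tabl_act (s : 'S_n) (t : word n p) : word n p :=
  [ffun k => t (s^-1%g k)].

Definition colstab : {set 'S_n} :=
  [set s : 'S_n | [forall k, col_of lam (s k) == col_of lam k]].

Definition rowstab : {set 'S_n} :=
  [set s : 'S_n | [forall k, row_of lam (s k) == row_of lam k]].

Definition row_equiv (t u : word n p) : bool :=
  [exists (s : 'S_n | s \in rowstab), u == tabl_act s t].

Definition e_ (C : numClosedFieldType) (t : word n p) : 'cV[C]_#|word n p| :=
  \sum_(s in colstab) (-1) ^+ s *: \sum_(u | row_equiv t u) chi C (tabl_act s u).

Hypothesis lam_le_p : (nparts lam <= p)%N.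

Definition t_ : word n p :=
  [ffun k => Ordinal (leq_trans (row_of_lt_nparts lam k) lam_le_p)].

End Tableaux.

Arguments e_ {n p} lam C t.
Arguments t_ {n p lam} lam_le_p.

Section Polynomials.
Variables (C : numClosedFieldType) (p : nat).

(* Polynomials in the p * p variables x_(i,j), numbered by mxvec_index        *)
Definition xvar (i j : 'I_p) : {mpoly C[p * p]} := 'X_(mxvec_index i j).

Definition xpow (D : 'M[nat]_p) : {mpoly C[p * p]} :=
  \prod_i \prod_j xvar i j ^+ D i j.

Definition pd (i j : 'I_p) (f : {mpoly C[p * p]}) : {mpoly C[p * p]} :=
  mderiv (mxvec_index i j) f.

Definition d_ (i j : 'I_p) (f : {mpoly C[p * p]}) : {mpoly C[p * p]} :=
  \sum_s xvar i s * pd j s f.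

Definition dstar (i j : 'I_p) (f : {mpoly C[p * p]}) : {mpoly C[p * p]} :=
  \sum_s xvar s j * pd s i f.

(* For k = 0 this is 1, the determinant of the empty matrix being 1.          *)
Definition Q_ (k : nat) (k_le_p : (k <= p)%N) : {mpoly C[p * p]} :=
  k`!%:R * \det (\matrix_(i < k, j < k)
                   xvar (widen_ord k_le_p i) (widen_ord k_le_p j)).

Definition P_ (n : nat) (lam : intpartn n) (lam_le_p : (nparts lam <= p)%N) :
    {mpoly C[p * p]} :=
  \prod_(i < n)
     Q_ (leq_trans (@dual_le_nparts n lam i.+1 (ltn0Sn i)) lam_le_p).

(* The composition over j, and for each j over i > j, in increasing order     *)
(* from left to right; the rightmost operator acts first.  The last index j   *)
(* contributes nothing, as there is no i > j.                                 *)
Definition raise_op (D' D'' : 'M[nat]_p) :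
    {mpoly C[p * p]} -> {mpoly C[p * p]} :=
  \big[comp/id]_(j < p) \big[comp/id]_(i < p | (j < i)%N)
     (iter (D'' i j) (d_ i j) \o iter (D' i j) (dstar j i)).

End Polynomials.

(* Main.v *)
Require Import Defs.
From HB Require Import structures.
From mathcomp Require Import all_boot all_order all_fingroup all_algebra.
From mathcomp Require Import mpoly complex reals.

(** Write [W a b] for the product of the variables [x_(a_k, b_k)] over the boxes
    [k] ([word_mono]).  Since the generating function of the matrices [A_D] is
    the [n]-th tensor power of the generic matrix [x], the left-hand side is the
    bilinear form with values [W] evaluated at [e_t''] and [e_t']: the sum, over
    the words [u] row equivalent to [t''] and [v] row equivalent to [t'], of the
    signed sum of [W] over the column group acting on [u] and on [v]
    ([sum_xpow_inner_e], with [colform u v] for the signed sum).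

    The operator [d_(i -> j)] is a derivation that sends [x_(j, s)] to
    [x_(i, s)], so it acts on [W a b] by replacing, one at a time, each letter
    [j] of [a] by [i]; the operator [dstar] does the same to [b].  Substituting
    letters commutes with permuting boxes, so both operators act on
    [colform u v] through [u] and [v] ([d_colform], [dstar_colform]).

    Every row equivalence class is determined by the off-diagonal entries of its
    matrix [D(t, t_lambda)], and for a semistandard tableau those above the
    diagonal vanish.  As long as the letter [j] occurs in row [j] only,
    replacing a letter [j] by [i] changes row [j] alone: applied to the sum over
    one class it yields a multiple of the sum over the class in which the entry
    [(i, j)] is one larger, the multiple being the new entry, because each word
    arises once for every [i] in its row [j] ([sum_subst_letter]).  Iterating
    [m] times from the entry 0 produces the factor [m`!].  The prescribed order
    raises the largest letters first, which keeps every [j] confined to its own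
    row until its turn comes, so the whole composition turns the class of
    [t_lambda] into that of [t''], respectively [t'], and multiplies by the
    product of the factorials ([raise_opE]).

    It remains to see that the form at the pair [(t_lambda, t_lambda)] is
    [P_lambda] ([colform_t]).  One of the two sums over the column group
    contributes its order, the product of the factorials of the column lengths
    ([card_fiber_perms]), and the other one is the Leibniz expansion of the
    determinant of a matrix that is block diagonal along the columns
    ([det_block_diagonal]). *)

Set Implicit Arguments.
Unset Strict Implicit.
Unset Printing Implicit Defensive.
Import GRing.Theory.
Local Open Scope ring_scope.

(** * Block matrices and permutations that respect a partition *)

(** Both sides are the determinant of the block matrix with diagonal blocks
    [1] and off-diagonal blocks [- A] and [B], eliminated from either corner. *)
Lemma det_add1_mulmx (K : comPzRingType) (m k : nat)
    (A : 'M[K]_(m, k)) (B : 'M[K]_(k, m)) :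
  \det (1%:M + A *m B) = \det (1%:M + B *m A).
Proof.
have eL : block_mx 1%:M (- A) B 1%:M =
    block_mx (1%:M + A *m B) (- A) 0 1%:M *m block_mx 1%:M 0 B 1%:M.
  rewrite mulmx_block !(mulmx1, mul1mx, mul0mx, mulmx0) ?mulNmx.
  by rewrite addrK !add0r.
have eR : block_mx 1%:M (- A) B 1%:M =
    block_mx 1%:M 0 B 1%:M *m block_mx 1%:M (- A) 0 (1%:M + B *m A).
  rewrite mulmx_block !(mulmx1, mul1mx, mul0mx, mulmx0) ?mulmxN.
  by rewrite !addr0 addrCA addNr addr0.
have := congr1 (@determinant _ _) eL; rewrite {1}eR !det_mulmx.
by rewrite !det_ublock !det_lblock !det1 !mulr1 !mul1r.
Qed.

Section Fibers.
Variables (n m : nat) (c : 'I_n -> 'I_m).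

(** The matrices with a single block, and the identity elsewhere, multiply to
    the block diagonal matrix; working with them keeps the order of the rows,
    so no sign of a reordering ever appears. *)
Definition block_restriction (K : pzRingType) (A : 'M[K]_n) (s : seq 'I_m) :=
  \matrix_(a, b) if (c a == c b) && (c a \in s) then A a b else (a == b)%:R.

Lemma block_restriction_cons (K : pzRingType) (A : 'M[K]_n) i s : i \notin s ->
  block_restriction A (i :: s)
  = block_restriction A s *m block_restriction A [:: i].
Proof.
move=> i_s; apply/matrixP => a b; rewrite !mxE.
have [cai|cai] := eqVneq (c a) i.
  rewrite (bigD1 a) //= !mxE cai (negPf i_s) andbF !inE !eqxx mul1r /=.
  rewrite big1 ?addr0 // => d da; rewrite !mxE cai (negPf i_s) andbF.
  by rewrite eq_sym (negPf da) mul0r.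
have [cbi|cbi] := eqVneq (c b) i.
  have ncab : c a == c b = false by rewrite cbi (negPf cai).
  have nab : a == b = false by apply/negP => /eqP ab; rewrite ab eqxx in ncab.
  rewrite ncab /= nab big1 // => d _; rewrite !mxE.
  have [cdi|cdi] := eqVneq (c d) i.
    rewrite cdi (negPf cai) /=.
    by case: eqP => [ad|_]; [rewrite ad cdi eqxx in cai | rewrite mul0r].
  have [db|_] := eqVneq d b; first by rewrite db cbi eqxx in cdi.
  by rewrite cbi (negPf cdi) mulr0.
rewrite (bigD1 b) //= !mxE !eqxx !inE (negPf cbi) mulr1 (negPf cai) /=.
rewrite big1 ?addr0 // => d db; rewrite !mxE !inE (negPf db).
by case: (eqVneq (c d) (c b)) => [->|_]; rewrite ?(negPf cbi) mulr0.
Qed.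

Variables (k : 'I_m -> nat) (h : forall i, 'I_(k i) -> 'I_n).
Hypothesis h_inj : forall i, injective (h (i := i)).
Hypothesis h_fiber : forall i a, c a == i <-> exists r : 'I_(k i), h r = a.

Let c_h i (r : 'I_(k i)) : c (h r) = i.
Proof. by apply/eqP/h_fiber; exists r. Qed.

(** The [i]-th block is transported to a matrix of order [k i] by the 0/1
    matrix of the enumeration [h]. *)
Lemma det_block_restriction1 (K : comPzRingType) (A : 'M[K]_n) i :
  \det (block_restriction A [:: i]) = \det (mxsub (h (i := i)) (h (i := i)) A).
Proof.
set B := mxsub _ _ _.
have [H HE] : exists H : 'M[K]_(n, k i), forall a r, H a r = (a == h r)%:R.
  by exists (\matrix_(a, r) (a == h r)%:R) => a r; rewrite mxE.
have HtH : H^T *m H = 1%:M.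
  apply/matrixP => r s; rewrite !mxE (bigD1 (h r)) //= mxE !HE eqxx mul1r.
  rewrite (inj_eq (@h_inj i)) big1 ?addr0 // => a /negPf a_r.
  by rewrite mxE HE a_r mul0r.
have -> : block_restriction A [:: i] = 1%:M + H *m ((B - 1%:M) *m H^T).
  apply/matrixP => a b; rewrite !mxE inE.
  have [/h_fiber [r <-]|cai] := boolP (c a == i); last first.
    rewrite andbF big1 ?addr0 // => r _; rewrite HE.
    case: eqP => [e|_]; last by rewrite mul0r.
    by rewrite e c_h eqxx in cai.
  rewrite andbT c_h (bigD1 r) //= big1 => [|s sr]; last first.
    by rewrite HE (inj_eq (@h_inj i)) eq_sym (negPf sr) mul0r.
  rewrite HE eqxx mul1r addr0 mxE.
  have [/h_fiber [s <-]|cbi] := boolP (c b == i); last first.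
    rewrite eq_sym (negPf cbi) big1 ?addr0 // => s _; rewrite [_^T _ _]mxE HE.
    by case: eqP => [e|_]; [rewrite e c_h eqxx in cbi | rewrite mulr0].
  rewrite c_h eqxx (bigD1 s) //= big1 => [|u us]; last first.
    by rewrite [_^T _ _]mxE HE (inj_eq (@h_inj i)) eq_sym (negPf us) mulr0.
  by rewrite !mxE HE eqxx mulr1 addr0 (inj_eq (@h_inj i)) addrC subrK.
by rewrite det_add1_mulmx -mulmxA HtH mulmx1 addrC subrK.
Qed.

(** The blocks need not consist of consecutive rows. *)
Lemma det_block_diagonal (K : comPzRingType) (A : 'M[K]_n) :
  (forall a b, c a != c b -> A a b = 0) ->
  \det A = \prod_i \det (mxsub (h (i := i)) (h (i := i)) A).
Proof.
move=> A0.
have det_s (s : seq 'I_m) : uniq s -> \det (block_restriction A s)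
    = \prod_(i <- s) \det (mxsub (h (i := i)) (h (i := i)) A).
  elim: s => [_|i s IHs /= /andP[i_s s_uniq]].
    rewrite big_nil -[RHS](det1 _ n); congr (\det _).
    by apply/matrixP => a b; rewrite !mxE andbF.
  rewrite big_cons block_restriction_cons // det_mulmx IHs // mulrC.
  by rewrite det_block_restriction1.
have -> : A = block_restriction A (index_enum 'I_m).
  apply/matrixP => a b; rewrite mxE mem_index_enum andbT.
  have [//|cab] := eqVneq (c a) (c b); rewrite A0 //.
  by case: (a =P b) cab => [->|]; rewrite ?eqxx.
rewrite det_s ?index_enum_uniq //; apply: eq_bigr => i _; congr (\det _).
by apply/matrixP => r s; rewrite !mxE !c_h eqxx mem_index_enum.
Qed.

(** Fixing the points outside the listed fibers makes an induction over the
    list possible. *)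
Definition fiber_perms (s : seq 'I_m) : {set 'S_n} :=
  [set x : 'S_n | [forall a, (c (x a) == c a) && ((c a \in s) || (x a == a))]].

Lemma fiber_permsP s (x : 'S_n) :
  reflect ((forall a, c (x a) = c a) /\ (forall a, c a \notin s -> x a = a))
    (x \in fiber_perms s).
Proof.
rewrite inE; apply: (iffP forallP) => [x_s|[x_c x_s] a].
  split=> a => [|/negPf as_]; have /andP[/eqP xc] := x_s a => //.
  by rewrite as_ => /eqP.
by rewrite x_c eqxx /=; case: (boolP (c a \in s)) => //= /x_s ->.
Qed.

Lemma fiber_perms_group_set s : group_set (fiber_perms s).
Proof.
apply/group_setP; split.
  by apply/fiber_permsP; split=> a; rewrite perm1.
move=> x y /fiber_permsP[xc xs] /fiber_permsP[yc ys].
by apply/fiber_permsP; split=> a => [|as_]; rewrite permM ?yc ?xc // xs // ys.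
Qed.
Canonical fiber_perms_group s := Group (fiber_perms_group_set s).

(** The permutations that act on [s] and on one further fiber form a direct
    product: restricting a permutation to that fiber splits off the symmetric
    group of the fiber. *)
Lemma card_fiber_perms_cons i s : i \notin s ->
  #|fiber_perms (i :: s)| = (#|[set a | c a == i]|`! * #|fiber_perms s|)%N.
Proof.
move=> i_s; set F := [set a | c a == i].
have F_c (x : 'S_n) : perm_on F x -> forall a, c (x a) = c a.
  move=> x_on a; have [aF|aF] := boolP (a \in F);
    last by rewrite (out_perm x_on).
  have: x a \in F by rewrite perm_closed.
  by move: aF; rewrite !inE => /eqP-> /eqP->.
rewrite -card_Sym -TI_cardMg; last first.
  apply/trivgP/subsetP => x; rewrite !inE => /andP[x_on].
  move=> /forallP x_s; apply/eqP/permP => a; rewrite perm1.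
  have [aF|aF] := boolP (a \in F); last by rewrite (out_perm x_on).
  have /andP[_ /orP[|/eqP //]] := x_s a.
  by move: aF; rewrite inE => /eqP->; rewrite (negPf i_s).
apply: eq_card => x; apply/fiber_permsP/mulsgP => [[xc xs]|[y z y_on]].
  have xN : x \in 'N(F | 'P)%g.
    by apply/astabsP => a; rewrite /= apermE !inE xc.
  have x_on := restr_perm_on F x.
  exists (restr_perm F x) ((restr_perm F x)^-1 * x)%g; rewrite ?mulKVg ?inE //.
  have eqF a : a \in F -> ((restr_perm F x)^-1 * x)%g a = a.
    move=> aF; rewrite permM; set b := fun_of_perm _ a.
    have ab : a = restr_perm F x b by rewrite /b permKV.
    have bF : b \in F by rewrite -(perm_closed _ x_on) -ab.
    by rewrite -(restr_permE xN bF).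
  have eqNF a : a \notin F -> ((restr_perm F x)^-1 * x)%g a = x a.
    move=> aF; rewrite permM; congr (x _).
    apply: (@perm_inj _ (restr_perm F x)).
    by rewrite permKV (out_perm x_on).
  apply/forallP => a; have [aF|aF] := boolP (a \in F).
    by rewrite eqF // !eqxx orbT.
  rewrite eqNF // xc eqxx /=; case: (boolP (c a \in s)) => //= as_.
  by rewrite xs // inE negb_or as_ andbT; move: aF; rewrite inE.
rewrite inE in y_on; move=> /fiber_permsP[zc zs] ->; split=> a.
  by rewrite permM zc F_c.
rewrite inE negb_or => /andP[ai as_]; rewrite permM (out_perm y_on) ?inE //.
exact: zs.
Qed.

Lemma card_fiber_perms (s : seq 'I_m) : uniq s ->
  #|fiber_perms s| = (\prod_(i <- s) #|[set a | c a == i]|`!)%N.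
Proof.
elim: s => [_|i s IHs /= /andP[i_s s_uniq]].
  rewrite big_nil -[RHS](cards1 (1%g : 'S_n)); congr #|pred_of_set _|.
  apply/setP => x; rewrite in_set1; apply/fiber_permsP/eqP => [[_ x1]|->].
    by apply/permP => a; rewrite perm1 x1.
  by split=> a; rewrite perm1.
by rewrite big_cons card_fiber_perms_cons // IHs.
Qed.

End Fibers.

(** * Boxes of a Ferrers diagram *)

Section Diagram.
Variables (n : nat) (lam : intpartn n).

Lemma part_anti i j : (i <= j)%N -> (nth 0 lam j <= nth 0 lam i)%N.
Proof.
move=> ij; have [jn|nj] := ltnP j (size lam); last by rewrite nth_default.
have geq_trans : transitive geq by move=> x y z /= ? /leq_trans; apply.
have := sorted_leq_nth geq_trans leqnn 0%N (part_sorted lam).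
by apply; rewrite ?inE ?(leq_ltn_trans ij).
Qed.

Lemma ltn_dual r c : (r < dual lam c.+1)%N = (c < nth 0 lam r)%N.
Proof.
have dual_le : (dual lam c.+1 <= size lam)%N by apply: count_size.
apply/idP/idP => [|cr].
  apply: contraTT; rewrite -!leqNgt => le_c.
  have [rn|nr] := ltnP r (size lam); last exact: leq_trans dual_le nr.
  rewrite /dual -(cat_take_drop r lam) count_cat.
  rewrite [X in (_ + X)%N](_ : _ = 0%N) ?addn0.
    by apply: leq_trans (count_size _ _) _; rewrite size_take rn.
  apply/eqP; rewrite -leqn0 leqNgt -has_count; apply/negP => /(has_nthP 0%N).
  case=> i _; rewrite nth_drop => c_lt.
  have := leq_trans c_lt (leq_trans (part_anti (leq_addr i r)) le_c).
  by rewrite ltnn.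
have rn : (r < size lam)%N.
  by rewrite ltnNge; apply/negP => /(nth_default 0%N) e; rewrite e in cr.
rewrite /dual -(cat_take_drop r.+1 lam) count_cat.
apply: leq_trans (leq_addr _ _).
suff -> : count (fun l => c.+1 <= l)%N (take r.+1 lam) = r.+1 by [].
have := size_takel rn; move=> {2}<-; apply/eqP; rewrite -all_count.
apply/(all_nthP 0%N) => i; rewrite size_takel // ltnS => ir.
by rewrite nth_take ?ltnS //; apply: leq_trans cr (part_anti ir).
Qed.

Lemma box_subproof c (r : 'I_(dual lam c.+1)) :
  (flatten_index lam r c < n)%N.
Proof.
by rewrite -[X in (_ < X)%N](part_sum lam) flatten_indexP -?ltn_dual.
Qed.

(** The boxes of column [c], enumerated from top to bottom. *)
Definition box c (r : 'I_(dual lam c.+1)) : 'I_n :=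
  Ordinal (box_subproof r).

Lemma row_box c (r : 'I_(dual lam c.+1)) : row_of lam (box r) = r.
Proof. by rewrite /row_of /= flatten_indexKl -?ltn_dual. Qed.

Lemma col_box c (r : 'I_(dual lam c.+1)) : col_of lam (box r) = c.
Proof. by rewrite /col_of /= flatten_indexKr -?ltn_dual. Qed.

Lemma box_inj c : injective (@box c).
Proof. by move=> r s /(congr1 (row_of lam)); rewrite !row_box => /val_inj. Qed.

Lemma col_of_lt (k : 'I_n) : (col_of lam k < n)%N.
Proof.
apply: leq_trans (box_in_row lam k) _.
have r_lt : (row_of lam k < size lam)%N.
  by apply: reshape_indexP; rewrite part_sum.
rewrite -[X in (_ <= X)%N](part_sum lam) sumnE (big_nth 0%N) big_mkord.
by rewrite (bigD1 (Ordinal r_lt)) //= leq_addr.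
Qed.

Definition column (k : 'I_n) : 'I_n := Ordinal (col_of_lt k).

Lemma column_fiber c k :
  column k == c <-> exists r : 'I_(dual lam c.+1), box r = k.
Proof.
split=> [/eqP <-|[r <-]]; last by apply/eqP/val_inj; rewrite /= col_box.
have r_lt : (row_of lam k < dual lam (column k).+1)%N.
  by rewrite ltn_dual box_in_row.
by exists (Ordinal r_lt); apply: val_inj; rewrite /= reshape_indexK.
Qed.

Lemma card_column c : #|[set k | column k == c]| = dual lam c.+1.
Proof.
rewrite -[RHS]card_ord -(card_imset _ (@box_inj c)); apply: eq_card => k.
rewrite inE; apply/idP/imsetP => [/column_fiber[r <-]|[r _ ->]].
  by exists r.
by apply/column_fiber; exists r.
Qed.

Lemma colstab_fiber_perms : colstab lam = fiber_perms column (index_enum 'I_n).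
Proof.
apply/setP => s; rewrite !inE; apply: eq_forallb => a.
by rewrite mem_index_enum andbT.
Qed.

(** In a column of a semistandard tableau the entries increase strictly,
    starting from at least 0. *)
Lemma semistandard_ge_row p (t : word n p) k :
  semistandard lam t -> (row_of lam k <= t k)%N.
Proof.
move=> ss; have [m] := ubnP (row_of lam k); elim: m k => // m IHm k.
case Erow: (row_of lam k) => [//|r]; rewrite ltnS => rm.
have c_lt : (r < dual lam (column k).+1)%N.
  rewrite ltn_dual; apply: leq_trans (box_in_row _ k) (part_anti _).
  by rewrite Erow.
(* The box just above [k] in its column has an entry at least [r]. *)
have := IHm (box (Ordinal c_lt)); rewrite row_box => /(_ rm).
move=> /leq_ltn_trans; apply.
have /forallP/(_ k)/andP[/implyP col_lt _] := forallP ss (box (Ordinal c_lt)).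
by apply: col_lt; rewrite col_box row_box Erow /= eqxx ltnS leqnn.
Qed.

End Diagram.

(** * Words, monomials and polarization *)

Definition subst_letter n p (k : 'I_n) (i : 'I_p) (u : word n p) : word n p :=
  [ffun l => if l == k then i else u l].

Lemma tabl_act_subst n p (s : 'S_n) k i (u : word n p) :
  subst_letter (s k) i (tabl_act s u) = tabl_act s (subst_letter k i u).
Proof.
by apply/ffunP => l; rewrite !ffunE -(inj_eq (@perm_inj _ s^-1%g)) permK.
Qed.

(** The product on the right keeps all its factors and alters the [i]-th one in
    place, which is the shape of a word with one substituted letter. *)
Lemma derivation_prod (A : comPzRingType) (d : A -> A) (I : finType)
    (F : I -> A) :
  (forall f g, d (f * g) = d f * g + f * d g) ->
  d (\prod_i F i) = \sum_i \prod_j (if j == i then d (F j) else F j).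
Proof.
move=> dM; have d1 : d 1 = 0.
  by have /esym/eqP := dM 1 1; rewrite !mulr1 mul1r -subr_eq0 addrK => /eqP.
elim: (index_enum I) (index_enum_uniq I) => [_|x s IHs /= /andP[x_s s_uniq]].
  by rewrite !big_nil.
rewrite !big_cons dM eqxx IHs //; congr (_ * _ + _).
  by apply: eq_big_seq => y ys; case: (y =P x) x_s => // <-; rewrite ys.
rewrite big_distrr; apply: eq_big_seq => y ys; rewrite big_cons.
by case: (x =P y) x_s => // ->; rewrite ys.
Qed.

Section Operators.
Variables (C : numClosedFieldType) (p : nat).
Implicit Types (i j : 'I_p) (f g : {mpoly C[p * p]}).

Lemma pd_xvar i j a b :
  pd i j (xvar C a b) = ((a == i) && (b == j))%:R%:MP.
Proof.
rewrite /pd /xvar mderivX mnmE.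
have -> : (mxvec_index a b == mxvec_index i j) = (a == i) && (b == j).
  by rewrite (inj_eq (@cast_ord_inj _ _ _)) (inj_eq enum_rank_inj).
case: andP => [[/eqP-> /eqP->]|_]; last by rewrite scale0r mpolyC0.
by rewrite scale1r -[X in (X - _)%MM]add0m addmK mpolyX0.
Qed.

Lemma d_is_linear i j : linear (@d_ C p i j).
Proof.
move=> c f g; rewrite /d_ scaler_sumr -big_split; apply: eq_bigr => s _ /=.
by rewrite /pd linearP mulrDr scalerAr.
Qed.
HB.instance Definition _ i j :=
  GRing.isLinear.Build C {mpoly C[p * p]} {mpoly C[p * p]} _ (d_ i j)
    (d_is_linear i j).

Lemma dstar_is_linear i j : linear (@dstar C p i j).
Proof.
move=> c f g; rewrite /dstar scaler_sumr -big_split; apply: eq_bigr => s _ /=.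
by rewrite /pd linearP mulrDr scalerAr.
Qed.
HB.instance Definition _ i j :=
  GRing.isLinear.Build C {mpoly C[p * p]} {mpoly C[p * p]} _ (dstar i j)
    (dstar_is_linear i j).

Lemma d_mul i j f g : d_ i j (f * g) = d_ i j f * g + f * d_ i j g.
Proof.
rewrite /d_ mulr_suml mulr_sumr -big_split; apply: eq_bigr => s _ /=.
by rewrite /pd mderivM mulrDr; congr (_ + _); [exact: mulrA | exact: mulrCA].
Qed.

Lemma dstar_mul i j f g : dstar i j (f * g) = dstar i j f * g + f * dstar i j g.
Proof.
rewrite /dstar mulr_suml mulr_sumr -big_split; apply: eq_bigr => s _ /=.
by rewrite /pd mderivM mulrDr; congr (_ + _); [exact: mulrA | exact: mulrCA].
Qed.

Lemma d_xvar i j a b :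
  d_ i j (xvar C a b) = if a == j then xvar C i b else 0.
Proof.
rewrite /d_ (bigD1 b) //= big1 ?addr0 => [|s sb]; last first.
  by rewrite pd_xvar eq_sym andbC eq_sym (negPf sb) mulr0.
by rewrite pd_xvar eqxx andbT; case: eqP; rewrite ?mulr1 ?mulr0.
Qed.

Lemma dstar_xvar i j a b :
  dstar i j (xvar C a b) = if b == i then xvar C a j else 0.
Proof.
rewrite /dstar (bigD1 a) //= big1 ?addr0 => [|s sa]; last first.
  by rewrite pd_xvar [a == s]eq_sym (negPf sa) mulr0.
by rewrite pd_xvar eqxx /=; case: eqP; rewrite ?mulr1 ?mulr0.
Qed.

(** The entry at [(a, b)] of the [n]-th tensor power of the generic matrix. *)
Definition word_mono n (a b : word n p) : {mpoly C[p * p]} :=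
  \prod_k xvar C (a k) (b k).

Lemma d_word_mono n i j (a b : word n p) :
  d_ i j (word_mono a b)
  = \sum_(k | a k == j) word_mono (subst_letter k i a) b.
Proof.
rewrite /word_mono (derivation_prod _ (@d_mul i j)) [RHS]big_mkcond.
apply: eq_bigr => k _; case: ifP => akj.
  apply: eq_bigr => l _; rewrite ffunE d_xvar.
  by case: eqP => // ->; rewrite akj.
by rewrite (bigD1 k) //= eqxx d_xvar akj mul0r.
Qed.

Lemma dstar_word_mono n i j (a b : word n p) :
  dstar j i (word_mono a b)
  = \sum_(k | b k == j) word_mono a (subst_letter k i b).
Proof.
rewrite /word_mono (derivation_prod _ (@dstar_mul j i)) [RHS]big_mkcond.
apply: eq_bigr => k _; case: ifP => bkj.
  apply: eq_bigr => l _; rewrite ffunE dstar_xvar.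
  by case: eqP => // ->; rewrite bkj.
by rewrite (bigD1 k) //= eqxx dstar_xvar bkj mul0r.
Qed.

Lemma xpow_Dmat n (a b : word n p) : xpow C (Dmat a b) = word_mono a b.
Proof.
rewrite /word_mono /xpow (partition_big a xpredT) //=; apply: eq_bigr => i _.
rewrite (partition_big b xpredT) //=; apply: eq_bigr => j _.
rewrite (eq_bigr (fun=> xvar C i j)) => [|k /andP[/eqP-> /eqP->] //].
by rewrite prodr_const mxE; congr (_ ^+ _); apply: eq_card => k; rewrite !inE.
Qed.

Lemma entry_sum_Dmat n (a b : word n p) : entry_sum (Dmat a b) = n.
Proof.
rewrite -[RHS]card_ord -sum1_card (partition_big a xpredT) //=.
apply: eq_bigr => i _; rewrite (partition_big b xpredT) //=.
by apply: eq_bigr => j _; rewrite mxE -sum1dep_card.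
Qed.

End Operators.

(** * The bilinear form on tableaux *)

Section Form.
Variables (C : numClosedFieldType) (n p : nat) (lam : intpartn n).
Implicit Types (u v t : word n p).

(** The pairing of the column antisymmetrizations of two words under the
    [n]-th tensor power of the generic matrix. *)
Definition colform u v : {mpoly C[p * p]} :=
  \sum_(s in colstab lam) \sum_(x in colstab lam)
    (-1) ^+ s *: ((-1) ^+ x *: word_mono C (tabl_act s u) (tabl_act x v)).

Lemma d_colform i j u v :
  d_ i j (colform u v)
  = \sum_(k | u k == j) colform (subst_letter k i u) v.
Proof.
rewrite /colform linear_sum [RHS]exchange_big; apply: eq_bigr => s _ /=.
rewrite linear_sum [RHS]exchange_big; apply: eq_bigr => x _ /=.
rewrite !linearZ /= d_word_mono !scaler_sumr (reindex_inj (@perm_inj _ s)) /=.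
by apply: eq_big => [k|k _]; rewrite ?ffunE ?permK // tabl_act_subst.
Qed.

Lemma dstar_colform i j u v :
  dstar j i (colform u v)
  = \sum_(k | v k == j) colform u (subst_letter k i v).
Proof.
rewrite /colform linear_sum [RHS]exchange_big; apply: eq_bigr => s _ /=.
rewrite linear_sum [RHS]exchange_big; apply: eq_bigr => x _ /=.
rewrite !linearZ /= dstar_word_mono !scaler_sumr.
rewrite (reindex_inj (@perm_inj _ x)) /=.
by apply: eq_big => [k|k _]; rewrite ?ffunE ?permK // tabl_act_subst.
Qed.

(** The vector [e_t], used as a linear functional on functions of words. *)
Lemma e_pairing (V : lmodType C) t (G : word n p -> V) :
  \sum_a e_ lam C t (enum_rank a) 0 *: G a
  = \sum_(s in colstab lam) \sum_(u | row_equiv lam t u)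
      (-1) ^+ s *: G (tabl_act s u).
Proof.
under eq_bigr => a _ do rewrite /e_ summxE scaler_suml.
rewrite exchange_big; apply: eq_bigr => s _ /=.
under eq_bigr => a _ do rewrite mxE summxE mulr_sumr scaler_suml.
rewrite exchange_big; apply: eq_bigr => u _ /=.
rewrite (bigD1 (tabl_act s u)) //= mxE !eqxx mulr1 big1 ?addr0 // => a a_neq.
by rewrite mxE (inj_eq enum_rank_inj) (negPf a_neq) mulr0 scale0r.
Qed.

Lemma e_conj t (b : 'I_#|word n p|) : (e_ lam C t b 0)^* = e_ lam C t b 0.
Proof.
apply: Num.Theory.conj_Creal; rewrite /e_ summxE; apply: rpred_sum => s _.
rewrite mxE summxE; apply: rpredM; first by rewrite rpredX // rpredN1.
apply: rpred_sum => u _; rewrite mxE.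
by case: (_ && _); rewrite ?rpred1 ?rpred0.
Qed.

(** For words [a] and [b] the only matrix [D] with [A_D] nonzero at [(a, b)] is
    [D(a, b)], and its monomial is [word_mono a b]. *)
Lemma sum_xpow_inner (x y : 'cV[C]_#|word n p|) :
  \sum_(D <- Pnp n p) inner (Amx C n D *m x) y *: xpow C D
  = \sum_a \sum_b ((y (enum_rank a) 0)^* * x (enum_rank b) 0)
      *: word_mono C a b.
Proof.
have innerE D : inner (Amx C n D *m x) y
    = \sum_(a : word n p) \sum_(b : word n p)
    ((y (enum_rank a) 0)^* * x (enum_rank b) 0) * (Dmat a b == D)%:R.
  have rank_bij : {on [pred i | xpredT i], bijective (@enum_rank (word n p))}.
    by apply: onW_bij; apply: enum_rank_bij.
  rewrite /inner mxE (reindex _ rank_bij) /=; apply: eq_bigr => a _.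
  rewrite !mxE (reindex _ rank_bij) /=.
  rewrite mulr_sumr; apply: eq_bigr => b _; rewrite mxE !enum_rankK.
  by rewrite -[RHS]mulrA [X in _ = _ * X]mulrC.
under eq_bigr => D _ do rewrite innerE scaler_suml.
rewrite exchange_big; apply: eq_bigr => a _ /=.
under eq_bigr => D _ do rewrite scaler_suml.
rewrite exchange_big; apply: eq_bigr => b _ /=.
rewrite (bigD1_seq (Dmat a b)) ?Pnp_uniq ?mem_Pnp ?entry_sum_Dmat //=.
rewrite eqxx mulr1 xpow_Dmat big1 ?addr0 // => D D_neq.
by rewrite eq_sym (negPf D_neq) mulr0 scale0r.
Qed.

Lemma sum_xpow_inner_e t' t'' :
  \sum_(D <- Pnp n p)
     inner (Amx C n D *m e_ lam C t') (e_ lam C t'') *: xpow C D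
  = \sum_(u | row_equiv lam t'' u) \sum_(v | row_equiv lam t' v) colform u v.
Proof.
rewrite sum_xpow_inner.
under eq_bigr => a _ do under eq_bigr => b _ do rewrite e_conj -scalerA.
under eq_bigr => a _ do rewrite -scaler_sumr (e_pairing t').
rewrite (e_pairing t'') exchange_big; apply: eq_bigr => u _ /=.
rewrite /colform [RHS]exchange_big; apply: eq_bigr => s _ /=.
rewrite [RHS]exchange_big scaler_sumr; apply: eq_bigr => x _.
by rewrite scaler_sumr.
Qed.

End Form.


(** * The form at the tableau with constant rows *)

Section Base.
Variables (C : numClosedFieldType) (n p : nat) (lam : intpartn n).
Hypothesis lam_le_p : (nparts lam <= p)%N.
Let t := t_ lam_le_p.

(** A pair of column permutations enters only through its quotient, so one of
    the two sums gives the order of the column group. *)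
Lemma colform_t_sum :
  colform C lam t t
  = (\sum_(x in colstab lam) (-1) ^+ x *: \prod_k xvar C (t k) (t (x k)))
      *+ #|colstab lam|.
Proof.
rewrite -sumr_const /colform colstab_fiber_perms; apply: eq_bigr => s sC.
rewrite (reindex_inj (h := fun x : 'S_n => (x^-1 * s)%g)) /=; last first.
  by move=> x y /mulIg /invg_inj.
apply: eq_big => [x|x _]; first by rewrite groupMr // groupV.
rewrite scalerA odd_permM odd_permV -signr_addb addbCA addbb addbF.
congr (_ *: _).
rewrite /word_mono (reindex_inj (@perm_inj _ s)); apply: eq_bigr => k _.
by rewrite !ffunE invMg invgK permM !permK.
Qed.

(** In the Leibniz expansion, the permutations that do not preserve the columns
    meet a zero entry. *)
Lemma sum_colstab_det :
  \sum_(x in colstab lam) (-1) ^+ x *: \prod_k xvar C (t k) (t (x k))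
  = \det (\matrix_(k, l)
      if column lam k == column lam l then xvar C (t k) (t l) else 0).
Proof.
rewrite [RHS](bigID (mem (colstab lam))) /= [X in _ + X]big1 ?addr0 => [|x].
  apply: eq_bigr => x; rewrite inE => /forallP xC.
  rewrite scaler_sign mulr_sign.
  case: ifP => _; [congr (- _)|]; apply: eq_bigr => k _;
    by rewrite mxE -val_eqE /= eq_sym xC.
rewrite inE negb_forall => /existsP[k xk].
by rewrite (bigD1 k) //= mxE -val_eqE /= eq_sym (negPf xk) mul0r mulr0.
Qed.

Lemma colform_t : colform C lam t t = P_ C lam_le_p.
Proof.
rewrite colform_t_sum sum_colstab_det.
rewrite (det_block_diagonal (@box_inj _ lam) (@column_fiber _ lam)) /=;
  last by move=> k l kl; rewrite mxE (negPf kl).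
rewrite colstab_fiber_perms card_fiber_perms ?index_enum_uniq //.
rewrite -mulr_natl natr_prod -big_split; apply: eq_bigr => i _ /=.
rewrite card_column; congr (_ * \det _); apply/matrixP => r s; rewrite !mxE.
rewrite -val_eqE /= !col_box eqxx.
by congr xvar; apply: val_inj; rewrite !ffunE /= row_box.
Qed.

End Base.

(** * Raising letters inside the rows *)

Section Raise.
Variables (n p : nat) (r : word n p).
Implicit Types (u : word n p) (N : 'M[nat]_p).

Lemma Dmat_sum u a b : Dmat u r a b = (\sum_k ((u k == a) && (r k == b)))%N.
Proof.
rewrite mxE -sum1dep_card big_mkcond.
by apply: eq_bigr => k _; case: (_ && _).
Qed.

Lemma Dmat_subst_letter k i u a b :
  (Dmat (subst_letter k i u) r a b + ((u k == a) && (r k == b))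
  = Dmat u r a b + ((i == a) && (r k == b)))%N.
Proof.
rewrite !Dmat_sum (bigD1 k) // [in RHS](bigD1 k) //= ffunE eqxx.
rewrite addnAC [in RHS]addnAC [X in (X + _)%N]addnC; congr (_ + _)%N.
by apply: eq_bigr => l /negPf lk; rewrite ffunE lk.
Qed.

(** A row of the diagram has a fixed number of boxes, so the off-diagonal
    entries determine the diagonal ones.  Leaving the diagonal out means that
    raising a letter [j] of row [j] changes a single entry. *)
Definition has_offdiag N : pred (word n p) :=
  fun u => [forall a, forall b, (a != b) ==> (Dmat u r a b == N a b)].

Lemma has_offdiagP N u :
  reflect (forall a b, a != b -> Dmat u r a b = N a b) (has_offdiag N u).
Proof.
apply: (iffP forallP) => [uN a b ab|uN a].
  by have /forallP/(_ b) := uN a; rewrite ab => /eqP.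
by apply/forallP => b; apply/implyP => /uN ->.
Qed.

Definition set_entry N i j m : 'M[nat]_p :=
  \matrix_(a, b) if (a == i) && (b == j) then m else N a b.

Lemma set_entryE N i j m a b :
  set_entry N i j m a b = if (a == i) && (b == j) then m else N a b.
Proof. by rewrite mxE. Qed.

(** Both sides count pairs of a word and a box of row [j]: on the left the box
    holds the letter [j] that is replaced, on the right it holds the [i] that
    has replaced it.  The hypothesis on the row [N j] forces every letter [j]
    to lie in row [j]. *)
Lemma sum_subst_letter (V : nmodType) (f : word n p -> V) N i j m :
  i != j -> (forall b, b != j -> N j b = 0%N) ->
  \sum_(u | has_offdiag (set_entry N i j m) u)
      \sum_(k | u k == j) f (subst_letter k i u)
  = (\sum_(u | has_offdiag (set_entry N i j m.+1) u) f u) *+ m.+1.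
Proof.
move=> ij Nj0.
have -> : (\sum_(u | has_offdiag (set_entry N i j m.+1) u) f u) *+ m.+1
    = \sum_(u | has_offdiag (set_entry N i j m.+1) u)
        \sum_(k | (u k == i) && (r k == j)) f u.
  rewrite -sumrMnl; apply: eq_bigr => u /has_offdiagP/(_ _ _ ij) uij.
  rewrite sumr_const; congr (_ *+ _); move: uij; rewrite !mxE !eqxx /= => <-.
  by apply: eq_card => k; rewrite !inE.
rewrite !pair_big_dep /=.
rewrite (reindex_onto (fun q => (subst_letter q.2 j q.1, q.2))
                      (fun q => (subst_letter q.2 i q.1, q.2))) /=.
  apply: eq_big => [[u k]|[u k]] /=; last first.
    case/andP=> _ /eqP[e]; by rewrite e.
  rewrite ffunE eqxx eqxx andbT xpair_eqE eqxx andbT.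
  (* The inverse substitution restores [u] exactly when box [k] of [u] holds
     the letter [i]. *)
  have -> : (subst_letter k i (subst_letter k j u) == u) = (u k == i).
    apply/eqP/eqP => [<-|uk]; first by rewrite !ffunE eqxx.
    by apply/ffunP => l; rewrite !ffunE; case: eqP => // ->.
  have [uk|] := eqVneq (u k) i; last by rewrite !andbF.
  rewrite andbT.
  have D_eq := Dmat_subst_letter k j u; rewrite uk in D_eq.
  apply/has_offdiagP/andP => [uN|[/has_offdiagP uN rkj] a b ab].
    (* Outside row [j], the letter [j] at box [k] would be an off-diagonal one,
       which [Nj0] excludes. *)
    have rkj : r k == j.
      apply: contraT => rkj; have := uN j (r k); rewrite eq_sym rkj => /(_ isT).
      rewrite set_entryE (negPf rkj) andbF Nj0 // => D0; have := D_eq j (r k).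
      by rewrite D0 !eqxx (negPf ij) addn1.
    split=> //; apply/has_offdiagP => a b ab; have := D_eq a b.
    rewrite uN // !set_entryE (eqP rkj).
    have -> : (j == a) && (j == b) = false.
      by apply/negP => /andP[/eqP ja /eqP jb]; rewrite -ja -jb eqxx in ab.
    rewrite addn0 => <-; rewrite [i == a]eq_sym [j == b]eq_sym.
    by case: ifP => // _; rewrite ?addn1 ?addn0.
  have := D_eq a b; rewrite uN // !set_entryE (eqP rkj).
  have -> : (j == a) && (j == b) = false.
    by apply/negP => /andP[/eqP ja /eqP jb]; rewrite -ja -jb eqxx in ab.
  rewrite addn0 [i == a]eq_sym [j == b]eq_sym.
  by case: ifP => _; rewrite ?addn1 ?addn0 // => -[].
move=> [u k] /= /andP[_ /eqP uk]; congr (_, _).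
by apply/ffunP => l; rewrite !ffunE; case: eqP => // ->.
Qed.

Variables (C : numClosedFieldType) (lam : intpartn n).
Implicit Types (i j : 'I_p) (M : 'M[nat]_p).

Definition class_form N M : {mpoly C[p * p]} :=
  \sum_(u | has_offdiag N u) \sum_(v | has_offdiag M v) colform C lam u v.

Lemma iter_d_class_form N M i j m :
  i != j -> (forall b, b != j -> N j b = 0%N) ->
  iter m (d_ i j) (class_form (set_entry N i j 0) M)
  = m`!%:R *: class_form (set_entry N i j m) M.
Proof.
move=> ij Nj0; elim: m => [|m IHm]; first by rewrite scale1r.
rewrite iterS IHm linearZ /= factS mulnC natrM -scalerA; congr (_ *: _).
rewrite scaler_nat.
rewrite -(sum_subst_letter _ _ ij Nj0) linear_sum; apply: eq_bigr => u _ /=.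
rewrite linear_sum [RHS]exchange_big; apply: eq_bigr => v _ /=.
exact: d_colform.
Qed.

Lemma iter_dstar_class_form N M i j m :
  i != j -> (forall b, b != j -> M j b = 0%N) ->
  iter m (dstar j i) (class_form N (set_entry M i j 0))
  = m`!%:R *: class_form N (set_entry M i j m).
Proof.
move=> ij Mj0; elim: m => [|m IHm]; first by rewrite scale1r.
rewrite iterS IHm linearZ /= factS mulnC natrM -scalerA; congr (_ *: _).
rewrite scaler_nat.
rewrite -sumrMnl linear_sum; apply: eq_bigr => u _ /=.
rewrite -(sum_subst_letter _ _ ij Mj0) linear_sum; apply: eq_bigr => v _ /=.
exact: dstar_colform.
Qed.

Variables (D' D'' : 'M[nat]_p).

Definition restrict (A : rel 'I_p) N : 'M[nat]_p :=
  \matrix_(a, b) if A a b then N a b else 0%N.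

(** Up to a scalar, the polynomial reached once the letters have been raised at
    the positions in [A]. *)
Definition stage (A : rel 'I_p) := class_form (restrict A D'') (restrict A D').

Lemma eq_stage (A B : rel 'I_p) : A =2 B -> stage A = stage B.
Proof.
move=> AB; have E N : restrict A N = restrict B N.
  by apply/matrixP => a b; rewrite !mxE AB.
by rewrite /stage !E.
Qed.

Definition raise_step i j : {mpoly C[p * p]} -> {mpoly C[p * p]} :=
  iter (D'' i j) (d_ i j) \o iter (D' i j) (dstar j i).

Lemma iter_dZ i j m c f :
  iter m (@d_ C p i j) (c *: f) = c *: iter m (d_ i j) f.
Proof. by elim: m => //= m ->; rewrite linearZ. Qed.

Lemma raise_stepZ i j c f : raise_step i j (c *: f) = c *: raise_step i j f.
Proof.
rewrite /raise_step /= -iter_dZ; congr iter.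
by elim: (D' i j) => //= m ->; rewrite linearZ.
Qed.

Definition raise_coef i j : C := (D' i j)`!%:R * (D'' i j)`!%:R.

Lemma raise_step_stage A i j :
  i != j -> ~~ A i j -> (forall b, b != j -> ~~ A j b) ->
  raise_step i j (stage A)
  = raise_coef i j
      *: stage (fun a b => A a b || (a == i) && (b == j)).
Proof.
move=> ij Aij Aj.
have E0 N : restrict A N = set_entry (restrict A N) i j 0.
  apply/matrixP => a b; rewrite set_entryE; case: andP => // -[/eqP-> /eqP->].
  by rewrite mxE (negPf Aij).
have E1 N : set_entry (restrict A N) i j (N i j)
    = restrict (fun a b => A a b || (a == i) && (b == j)) N.
  apply/matrixP => a b; rewrite set_entryE !mxE.
  by case: andP => [[/eqP-> /eqP->]|]; rewrite ?orbT ?orbF.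
have Z N b : b != j -> restrict A N j b = 0%N.
  by move=> bj; rewrite mxE (negPf (Aj b bj)).
rewrite /raise_step /stage /= [restrict A D']E0 iter_dstar_class_form //;
  last exact: Z.
rewrite iter_dZ [restrict A D'']E0 iter_d_class_form //; last exact: Z.
by rewrite scalerA !E1.
Qed.

(** Inside one column [j] the order of the steps is irrelevant: they only put
    letters [i] different from [j] into row [j]. *)
Lemma raise_steps_row A j (s : seq 'I_p) :
  uniq s -> (forall i, ~~ A i j) -> (forall b, b != j -> ~~ A j b) ->
  (\big[comp/id]_(i <- s | (j < i)%N) raise_step i j) (stage A)
  = (\prod_(i <- s | (j < i)%N) raise_coef i j)
      *: stage (fun a b => A a b || [&& a \in s, b == j & (j < a)%N]).
Proof.
move=> + Aij Ajb; elim: s => [_|i s IHs /= /andP[i_s s_uniq]].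
  rewrite !big_nil scale1r; apply: eq_stage => a b.
  by rewrite in_nil orbF.
rewrite !big_cons; case: ifP => [ji|nji]; last first.
  rewrite IHs //; congr (_ *: _); apply: eq_stage => a b; rewrite inE.
  by case: (a =P i) => //= ->; rewrite nji !andbF.
rewrite /= IHs // raise_stepZ mulrC -scalerA; congr (_ *: _).
rewrite raise_step_stage ?negb_or ?Aij ?(negPf i_s) //.
- congr (_ *: _); apply: eq_stage => a b; rewrite inE -orbA; congr (_ || _).
  by case: (eqVneq a i) => [->|]; rewrite ?orbF // (negPf i_s) ji andbT.
- by rewrite neq_ltn ji orbT.
by move=> b bj; rewrite (negPf (Ajb b bj)) (negPf bj) andbF.
Qed.

(** The columns of [D'] and [D''] beyond [j] are processed before column [j],
    and this puts no letter [j] anywhere: it only introduces letters larger than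
    the index of a processed column.  Sortedness of [s] is what provides this
    order. *)
Lemma raise_steps (s : seq 'I_p) : sorted (relpre val ltn) s ->
  (\big[comp/id]_(j <- s) \big[comp/id]_(i < p | (j < i)%N) raise_step i j)
    (stage (fun _ _ => false))
  = (\prod_(j <- s) \prod_(i < p | (j < i)%N) raise_coef i j)
      *: stage (fun a b => (b \in s) && (b < a)%N).
Proof.
elim: s => [_|j s IHs s_sorted].
  by rewrite !big_nil scale1r; apply: eq_stage.
have lt_s b : b \in s -> (j < b)%N.
  have lt_trans : transitive (relpre (val : 'I_p -> nat) ltn).
    by move=> x y z /=; apply: ltn_trans.
  by have /allP := order_path_min lt_trans s_sorted; apply.
rewrite !big_cons /= IHs ?(path_sorted s_sorted) //.
have rowZ c f : (\big[comp/id]_(i < p | (j < i)%N) raise_step i j) (c *: f)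
    = c *: (\big[comp/id]_(i < p | (j < i)%N) raise_step i j) f.
  elim/big_ind: _ c f => // [g h gZ hZ|i _] c f; last exact: raise_stepZ.
  by rewrite /= hZ gZ.
rewrite rowZ raise_steps_row ?index_enum_uniq //.
- rewrite scalerA mulrC; congr (_ *: _); apply: eq_stage => a b.
  rewrite mem_index_enum inE; case: (eqVneq b j) => [->|_] /=;
    last by rewrite orbF.
  by case: (j < a)%N; rewrite ?andbF ?orbT.
- by move=> i; apply/negP => /andP[/lt_s]; rewrite ltnn.
by move=> b _; apply/negP => /andP[/lt_s jb]; rewrite ltnNge ltnW.
Qed.

Lemma raise_opE :
  raise_op D' D'' (stage (fun _ _ => false))
  = (\prod_(i < p) \prod_(j < p | (j < i)%N) raise_coef i j)
      *: stage (fun a b => (b < a)%N).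
Proof.
have enum_sorted : sorted (relpre val ltn) (index_enum 'I_p).
  rewrite [index_enum _]unlock -enumT -sorted_map.
  by rewrite val_enum_ord iota_ltn_sorted.
apply: etrans (raise_steps enum_sorted) _.
rewrite (exchange_big_dep xpredT) //=; congr (_ *: _).
by apply: eq_stage => a b; rewrite mem_index_enum.
Qed.

End Raise.

(** * Row equivalence classes of tableaux *)

Section RowClasses.
Variables (n p : nat).
Implicit Types (r t u : word n p).

Lemma Dmat_col_sum u r b : (\sum_a Dmat u r a b = \sum_k (r k == b))%N.
Proof.
under eq_bigr => a _ do rewrite Dmat_sum.
rewrite exchange_big; apply: eq_bigr => k _ /=.
rewrite (bigD1 (u k)) //= eqxx big1 ?addn0 // => a /negPf.
by rewrite eq_sym => ->.
Qed.

Lemma has_offdiag_Dmat r t u :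
  has_offdiag r (Dmat t r) u = (Dmat u r == Dmat t r).
Proof.
apply/has_offdiagP/eqP => [utr|-> //]; apply/matrixP => a b.
have [->|/utr //] := eqVneq a b.
have := Dmat_col_sum u r b; rewrite -(Dmat_col_sum t) (bigD1 b) //=.
rewrite [in RHS](bigD1 b) //= (eq_bigr (fun a => Dmat t r a b)) => [/addIn //|].
by move=> i /utr.
Qed.

(** With no off-diagonal letters at all, row [j] contains only [j]'s. *)
Lemma has_offdiag0 r u : has_offdiag r 0 u = (u == r).
Proof.
apply/has_offdiagP/eqP => [u0|-> a b ab].
  apply/ffunP => k; apply: contraTeq isT => /= /u0 /eqP.
  rewrite Dmat_sum mxE sum_nat_eq0 => /forallP/(_ k).
  by rewrite !eqxx.
rewrite Dmat_sum mxE big1 // => k _; case: eqP => // ->.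
by rewrite (negPf ab).
Qed.

Variable lam : intpartn n.
Hypothesis lam_le_p : (nparts lam <= p)%N.
Let r := t_ lam_le_p.

(** Equal counts mean that the sequences of pairs (letter, row) of the two
    tableaux are permutations of each other; such a permutation of the boxes
    preserves the rows. *)
Lemma row_equivE t u : row_equiv lam t u = (Dmat u r == Dmat t r).
Proof.
have r_eq k l : (r k == r l) = (row_of lam k == row_of lam l).
  by rewrite -val_eqE !ffunE.
apply/existsP/eqP => [[s /andP[]]|Dut].
  rewrite inE => /forallP s_row /eqP ->; apply/matrixP => a b.
  rewrite !Dmat_sum (reindex_inj (@perm_inj _ s)); apply: eq_bigr => k _.
  by rewrite ffunE permK; have /eqP -> : r (s k) == r k by rewrite r_eq.
pose f := fun v : word n p => [tuple (v k, r k) | k < n].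
have countf v a b : count_mem (a, b) (f v) = Dmat v r a b.
  rewrite Dmat_sum /f /= count_map -sum1_count big_mkcond big_enum /=.
  by apply: eq_bigr => k _; rewrite /= xpair_eqE; case: (_ && _).
have /tuple_permP[s def_s] : perm_eq (f u) (f t).
  by apply/allP => -[a b] _ /=; rewrite !countf Dut.
have s_eq k : (u k, r k) = (t (s k), r (s k)).
  have := congr1 (fun x => tnth x k) (val_inj def_s : f u = _).
  by rewrite !tnth_mktuple.
exists s^-1%g; rewrite inE; apply/andP; split.
  apply/forallP => k; rewrite -r_eq; have := s_eq (s^-1%g k).
  by rewrite permKV => -[_ ->].
by apply/eqP/ffunP => k; rewrite ffunE invgK; case: (s_eq k).
Qed.

(** A semistandard tableau has no letter [a] in row [b] for [a < b]. *)
Lemma semistandard_row_equiv t u : semistandard lam t ->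
  row_equiv lam t u
  = has_offdiag r (restrict (fun a b => b < a)%N (Dmat t r)) u.
Proof.
move=> ss; rewrite row_equivE -has_offdiag_Dmat.
apply: eq_forallb => a; apply: eq_forallb => b; case: (eqVneq a b) => //= ab.
rewrite [restrict _ _ _ _]mxE; case: ltngtP => // [lt_ab|/val_inj e].
  rewrite [X in _ == X]Dmat_sum big1 // => k _.
  case: eqP => //= tk; case: eqP => // rk; have := semistandard_ge_row k ss.
  have -> : row_of lam k = b by rewrite -rk ffunE.
  by rewrite tk leqNgt lt_ab.
by rewrite e eqxx in ab.
Qed.

End RowClasses.

(** * The generating function *)

Theorem theorem7 (R : realType) (n p : nat) (n_gt0 : (0 < n)%N)
    (p_gt0 : (0 < p)%N) (lam : intpartn n) (lam_le_p : (nparts lam <= p)%N)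
    (t' t'' : word n p) (ss' : semistandard lam t')
    (ss'' : semistandard lam t'') :
  let D' := Dmat t' (t_ lam_le_p) in
  let D'' := Dmat t'' (t_ lam_le_p) in
  let q := raise_op D' D'' (P_ R[i] lam_le_p) in
  \sum_(D <- Pnp n p)
     inner (Amx R[i] n D *m e_ lam R[i] t') (e_ lam R[i] t'') *: xpow R[i] D
  = (\prod_(i < p) \prod_(j < p | (j < i)%N)
       ((D' i j)`!%:R * (D'' i j)`!%:R)^-1) *: q.
Proof.
move=> D' D'' q; pose r := t_ lam_le_p.
rewrite sum_xpow_inner_e.
under eq_bigl => u do rewrite (semistandard_row_equiv lam_le_p u ss'').
under eq_bigr => u _ do
  under eq_bigl => v do rewrite (semistandard_row_equiv lam_le_p v ss').
have P_stage : P_ R[i] lam_le_p = stage r R[i] lam D' D'' (fun _ _ => false).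
  have E0 (N : 'M[nat]_p) : restrict (fun _ _ => false) N = 0.
    by apply/matrixP => a b; rewrite !mxE.
  rewrite /stage /class_form !E0 (big_pred1 r) => [|u];
    last exact: has_offdiag0.
  by rewrite (big_pred1 r) ?colform_t // => v; exact: has_offdiag0.
rewrite /q P_stage raise_opE scalerA -big_split.
rewrite [X in _ = X *: _]big1 ?scale1r // => i _ /=.
rewrite -big_split big1 // => j _ /=; rewrite mulVf //.
by rewrite mulf_neq0 // Num.Theory.pnatr_eq0 -lt0n fact_gt0.
Qed.
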